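(* Let $\mathcal C$ be a ribbon monoidal category with coequalizers, with braiding $c$ and twist $\theta$, and let $A$ be a commutative algebra in $\mathcal C$. Then $D(A)\in\mathcal C_A^{\mathrm{loc}}$ if and only if $\theta_A^2=\mathrm{id}_A$. If these equivalent conditions are satisfied, then $D(M)\in\mathcal C_A^{\mathrm{loc}}$ for all $M\in\mathcal C_A^{\mathrm{loc}}$.
   Context: A ribbon category is a rigid braided monoidal category with a natural isomorphism $\theta:\mathrm{id}\Rightarrow\mathrm{id}$ satisfying $\theta_{X\otimes Y}=(\theta_X\otimes\theta_Y)c_{Y,X}c_{X,Y}$ and $(\theta_X)^*=\theta_{X^*}$, where $X^*$ is the left dual with $\mathrm{ev}_X:X^*\otimes X\to\mathbf 1$. We identify $(X\otimes Y)^*=Y^*\otimes X^*$. An algebra $(A,\mu,\eta)$ is commutative if $\mu c_{A,A}=\mu$. $\mathcal C_A$ is the category of right $A$-modules $(M,a_M^r)$; each such $M$ is regarded as an $A$-bimodule with left action $a_M^\ell=a_M^r\circ c_{A,M}$. $M$ is local if $a_M^r c_{A,M}c_{M,A}=a_M^r$; $\mathcal C_A^{\mathrm{loc}}$ is the full subcategory of local modules. For $M\in\mathcal C_A$, $D(M)\in\mathcal C_A$ denotes the object $M^*$ with right $A$-action $a^r_{D(M)}=(\mathrm{id}_{M^*}\otimes\mathrm{ev}_A)\circ((a_M^\ell)^*\otimes\mathrm{id}_A):M^*\otimes A\to M^*$. *)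

(* Defs.v *)
From Corelib Require Import ssreflect.

Set Implicit Arguments.
Unset Strict Implicit.
Unset Printing Implicit Defensive.

Declare Scope cat_scope.
Delimit Scope cat_scope with cat.
Local Open Scope cat_scope.

Record category := Category {
  Ob :> Type;
  Hom : Ob -> Ob -> Type;
  idm : forall X, Hom X X;
  comp : forall X Y Z, Hom Y Z -> Hom X Y -> Hom X Z;
  comp1m : forall X Y (f : Hom X Y), comp (idm Y) f = f;
  compm1 : forall X Y (f : Hom X Y), comp f (idm X) = f;
  compA : forall W X Y Z (h : Hom Y Z) (g : Hom X Y) (f : Hom W X),
    comp (comp h g) f = comp h (comp g f)
}.
Arguments Hom {c} X Y.
Arguments idm {c} X.
Arguments comp {c X Y Z} g f : rename.
Arguments comp1m {c X Y} f.
Arguments compm1 {c X Y} f.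
Arguments compA {c W X Y Z} h g f.

Notation "g ∘ f" := (comp g f) (at level 39, right associativity) : cat_scope.

Definition has_coequalizers (C : category) : Prop :=
  forall (X Y : C) (f g : Hom X Y), exists (Q : C) (q : Hom Y Q),
    q ∘ f = q ∘ g /\
    forall (Z : C) (h : Hom Y Z), h ∘ f = h ∘ g ->
      exists! u : Hom Q Z, u ∘ q = h.

(** Not assumed strict. *)
Record monoidal := Monoidal {
  mcat :> category;
  tens : mcat -> mcat -> mcat;
  tensm : forall X X' Y Y' : mcat,
    Hom X X' -> Hom Y Y' -> Hom (tens X Y) (tens X' Y');
  tens1 : forall X Y : mcat, tensm (idm X) (idm Y) = idm (tens X Y);
  tensD : forall (X X' X'' Y Y' Y'' : mcat) (g : Hom X' X'') (f : Hom X X')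
      (k : Hom Y' Y'') (h : Hom Y Y'),
    tensm (g ∘ f) (k ∘ h) = tensm g k ∘ tensm f h;
  munit : mcat;

  assoc : forall X Y Z : mcat, Hom (tens (tens X Y) Z) (tens X (tens Y Z));
  assocV : forall X Y Z : mcat, Hom (tens X (tens Y Z)) (tens (tens X Y) Z);
  assocK : forall X Y Z : mcat, assocV X Y Z ∘ assoc X Y Z = idm _;
  assocVK : forall X Y Z : mcat, assoc X Y Z ∘ assocV X Y Z = idm _;
  assoc_nat : forall (X X' Y Y' Z Z' : mcat)
      (f : Hom X X') (g : Hom Y Y') (h : Hom Z Z'),
    assoc X' Y' Z' ∘ tensm (tensm f g) h = tensm f (tensm g h) ∘ assoc X Y Z;

  lunit : forall X : mcat, Hom (tens munit X) X;
  lunitV : forall X : mcat, Hom X (tens munit X);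
  lunitK : forall X : mcat, lunitV X ∘ lunit X = idm _;
  lunitVK : forall X : mcat, lunit X ∘ lunitV X = idm _;
  lunit_nat : forall (X Y : mcat) (f : Hom X Y),
    lunit Y ∘ tensm (idm munit) f = f ∘ lunit X;

  runit : forall X : mcat, Hom (tens X munit) X;
  runitV : forall X : mcat, Hom X (tens X munit);
  runitK : forall X : mcat, runitV X ∘ runit X = idm _;
  runitVK : forall X : mcat, runit X ∘ runitV X = idm _;
  runit_nat : forall (X Y : mcat) (f : Hom X Y),
    runit Y ∘ tensm f (idm munit) = f ∘ runit X;

  triangle : forall X Y : mcat,
    tensm (idm X) (lunit Y) ∘ assoc X munit Y = tensm (runit X) (idm Y);
  pentagon : forall W X Y Z : mcat,
    tensm (idm W) (assoc X Y Z) ∘ assoc W (tens X Y) Z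
      ∘ tensm (assoc W X Y) (idm Z)
    = assoc W X (tens Y Z) ∘ assoc (tens W X) Y Z
}.
Arguments tens {m} X Y.
Arguments tensm {m X X' Y Y'} f g : rename.
Arguments tens1 {m} X Y.
Arguments tensD {m X X' X'' Y Y' Y''} g f k h.
Arguments munit {m}.
Arguments assoc {m} X Y Z.
Arguments assocV {m} X Y Z.
Arguments assocK {m} X Y Z.
Arguments assocVK {m} X Y Z.
Arguments assoc_nat {m X X' Y Y' Z Z'} f g h.
Arguments lunit {m} X.
Arguments lunitV {m} X.
Arguments lunitK {m} X.
Arguments lunitVK {m} X.
Arguments lunit_nat {m X Y} f.
Arguments runit {m} X.
Arguments runitV {m} X.
Arguments runitK {m} X.
Arguments runitVK {m} X.
Arguments runit_nat {m X Y} f.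
Arguments triangle {m} X Y.
Arguments pentagon {m} W X Y Z.

Notation "X ⊗ Y" := (tens X Y) (at level 35, right associativity) : cat_scope.
Notation "f ⊗₁ g" := (tensm f g) (at level 35, right associativity) : cat_scope.
Notation "'𝟏'" := munit : cat_scope.

Record braided := Braided {
  bmon :> monoidal;
  braid : forall X Y : bmon, Hom (X ⊗ Y) (Y ⊗ X);
  braidV : forall X Y : bmon, Hom (Y ⊗ X) (X ⊗ Y);
  braidK : forall X Y : bmon, braidV X Y ∘ braid X Y = idm _;
  braidVK : forall X Y : bmon, braid X Y ∘ braidV X Y = idm _;
  braid_nat : forall (X X' Y Y' : bmon) (f : Hom X X') (g : Hom Y Y'),
    braid X' Y' ∘ (f ⊗₁ g) = (g ⊗₁ f) ∘ braid X Y;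
  hexagon_l : forall X Y Z : bmon,
    assoc Y Z X ∘ braid X (Y ⊗ Z) ∘ assoc X Y Z
    = (idm Y ⊗₁ braid X Z) ∘ assoc Y X Z ∘ (braid X Y ⊗₁ idm Z);
  hexagon_r : forall X Y Z : bmon,
    assocV Z X Y ∘ braid (X ⊗ Y) Z ∘ assocV X Y Z
    = (braid X Z ⊗₁ idm Y) ∘ assocV X Z Y ∘ (idm X ⊗₁ braid Y Z)
}.
Arguments braid {b} X Y.
Arguments braidV {b} X Y.
Arguments braidK {b} X Y.
Arguments braidVK {b} X Y.
Arguments braid_nat {b X X' Y Y'} f g.
Arguments hexagon_l {b} X Y Z.
Arguments hexagon_r {b} X Y Z.

(** [duality D X] exhibits [D] as a left dual of [X], equivalently [X] as a
    right dual of [D]. *)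
Record duality (C : monoidal) (D X : C) := Duality {
  dev : Hom (D ⊗ X) 𝟏;
  dcoev : Hom 𝟏 (X ⊗ D);
  zigzag_obj :
    runit X ∘ (idm X ⊗₁ dev) ∘ assoc X D X ∘ (dcoev ⊗₁ idm X) ∘ lunitV X
    = idm X;
  zigzag_dual :
    lunit D ∘ (dev ⊗₁ idm D) ∘ assocV D X D ∘ (idm D ⊗₁ dcoev) ∘ runitV D
    = idm D
}.

Record left_dual (C : monoidal) (X : C) := LeftDual {
  ldobj :> C;
  ldual_duality : duality ldobj X
}.

Record right_dual (C : monoidal) (X : C) := RightDual {
  rdobj :> C;
  rdual_duality : duality X rdobj
}.

Definition ev (C : monoidal) (X : C) (dX : left_dual X) : Hom (dX ⊗ X) 𝟏 :=
  dev (ldual_duality dX).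
Definition coev (C : monoidal) (X : C) (dX : left_dual X) : Hom 𝟏 (X ⊗ dX) :=
  dcoev (ldual_duality dX).

(** The adjunction bijection Hom(W ⊗ X, Z) -> Hom(W, Z ⊗ X^* ). *)
Definition transp (C : monoidal) (X : C) (dX : left_dual X) (W Z : C)
    (g : Hom (W ⊗ X) Z) : Hom W (Z ⊗ dX) :=
  (g ⊗₁ idm dX) ∘ assocV W X dX ∘ (idm W ⊗₁ coev dX) ∘ runitV W.

(** f^* = (ev_Y ⊗ id)(id ⊗ f ⊗ id)(id ⊗ coev_X) : Y^* -> X^*. *)
Definition dualm (C : monoidal) (X Y : C) (dX : left_dual X) (dY : left_dual Y)
    (f : Hom X Y) : Hom dY dX :=
  lunit dX ∘ transp dX (ev dY ∘ (idm dY ⊗₁ f)).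

(** The canonical map (X ⊗ Y)^* -> Y^* ⊗ X^*.  By [dual_tensE] it is the one
    compatible with the evaluations, and by [dual_tensK], [dual_tensVK] it is
    an isomorphism; it realises the identification (X ⊗ Y)^* = Y^* ⊗ X^*. *)
Definition dual_tens (C : monoidal) (X Y : C) (dX : left_dual X)
    (dY : left_dual Y) (dXY : left_dual (X ⊗ Y)) : Hom dXY (dY ⊗ dX) :=
  transp dX (lunit dY ∘ transp dY (ev dXY ∘ assoc dXY X Y)).

Definition ev_tens (C : monoidal) (X Y : C) (dX : left_dual X)
    (dY : left_dual Y) : Hom ((dY ⊗ dX) ⊗ (X ⊗ Y)) 𝟏 :=
  ev dY ∘ ((runit dY ∘ (idm dY ⊗₁ ev dX) ∘ assoc dY dX X) ⊗₁ idm Y)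
    ∘ assocV (dY ⊗ dX) X Y.

Definition dual_tensV (C : monoidal) (X Y : C) (dX : left_dual X)
    (dY : left_dual Y) (dXY : left_dual (X ⊗ Y)) : Hom (dY ⊗ dX) dXY :=
  lunit dXY ∘ transp dXY (ev_tens dX dY).

Record ribbon := Ribbon {
  rbraided :> braided;
  ldual : forall X : rbraided, left_dual X;
  rdual : forall X : rbraided, right_dual X;
  twist : forall X : rbraided, Hom X X;
  twistV : forall X : rbraided, Hom X X;
  twistK : forall X : rbraided, twistV X ∘ twist X = idm X;
  twistVK : forall X : rbraided, twist X ∘ twistV X = idm X;
  twist_nat : forall (X Y : rbraided) (f : Hom X Y),
    twist Y ∘ f = f ∘ twist X;
  twist_tens : forall X Y : rbraided,
    twist (X ⊗ Y) = (twist X ⊗₁ twist Y) ∘ braid Y X ∘ braid X Y;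
  twist_dual : forall X : rbraided,
    dualm (ldual X) (ldual X) (twist X) = twist (ldual X)
}.
Arguments ldual {r} X.
Arguments rdual {r} X.
Arguments twist {r} X.
Arguments twistV {r} X.
Arguments twistK {r} X.
Arguments twistVK {r} X.
Arguments twist_nat {r X Y} f.
Arguments twist_tens {r} X Y.
Arguments twist_dual {r} X.

Record algebra (C : monoidal) := Algebra {
  alg_obj :> C;
  amul : Hom (alg_obj ⊗ alg_obj) alg_obj;
  aone : Hom 𝟏 alg_obj;
  amulA : amul ∘ (amul ⊗₁ idm alg_obj)
    = amul ∘ (idm alg_obj ⊗₁ amul) ∘ assoc alg_obj alg_obj alg_obj;
  amul1l : amul ∘ (aone ⊗₁ idm alg_obj) = lunit alg_obj;
  amul1r : amul ∘ (idm alg_obj ⊗₁ aone) = runit alg_obj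
}.
Arguments amul {C} a.
Arguments aone {C} a.

Record comm_algebra (C : braided) := CommAlgebra {
  calg :> algebra C;
  amulC : amul calg ∘ braid calg calg = amul calg
}.

Record rmodule (C : monoidal) (A : algebra C) := RModule {
  mod_obj :> C;
  ract : Hom (mod_obj ⊗ A) mod_obj;
  ractA : ract ∘ (ract ⊗₁ idm A)
    = ract ∘ (idm mod_obj ⊗₁ amul A) ∘ assoc mod_obj A A;
  ract1 : ract ∘ (idm mod_obj ⊗₁ aone A) = runit mod_obj
}.
Arguments ract {C A} r.

Definition regular (C : monoidal) (A : algebra C) : rmodule A :=
  RModule (amulA A) (amul1r A).

Definition lact (C : braided) (A : algebra C) (M : rmodule A) : Hom (A ⊗ M) M :=
  ract M ∘ braid A M.

Definition is_local (C : braided) (A : algebra C) (M : rmodule A) : Prop :=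
  ract M ∘ braid A M ∘ braid M A = ract M.

(** a^r_{D(M)} = (id ⊗ ev_A)((a^l_M)^* ⊗ id_A) : M^* ⊗ A -> M^*. *)
Definition dual_ract (C : ribbon) (A : algebra C) (M : rmodule A) :
    Hom (ldual M ⊗ A) (ldual M) :=
  runit (ldual M) ∘ (idm (ldual M) ⊗₁ ev (ldual A))
    ∘ assoc (ldual M) (ldual A) A
    ∘ ((dual_tens (ldual A) (ldual M) (ldual (A ⊗ M))
         ∘ dualm (ldual (A ⊗ M)) (ldual M) (lact M)) ⊗₁ idm A).

Lemma compE (C : category) (W X Y Z : C) (f : Hom Y Z) (g : Hom X Y)
    (h : Hom X Z) (k : Hom W X) : f ∘ g = h -> f ∘ g ∘ k = h ∘ k.
Proof. by move=> <-; rewrite compA. Qed.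

Lemma compE3 (C : category) (V W X Y Z : C) (f : Hom Y Z) (g : Hom X Y)
    (h : Hom W X) (l : Hom W Z) (k : Hom V W) :
  f ∘ g ∘ h = l -> f ∘ g ∘ h ∘ k = l ∘ k.
Proof. by move=> <-; rewrite !compA. Qed.

Lemma cancel_mono (C : category) (X Y Z : C) (i : Hom Y Z) (j : Hom Z Y)
    (f g : Hom X Y) : j ∘ i = idm Y -> i ∘ f = i ∘ g -> f = g.
Proof.
by move=> ji e; rewrite -(comp1m f) -(comp1m g) -ji !compA e.
Qed.

Lemma cancel_epi (C : category) (X Y Z : C) (i : Hom X Y) (j : Hom Y X)
    (f g : Hom Y Z) : i ∘ j = idm Y -> f ∘ i = g ∘ i -> f = g.
Proof.
by move=> ij e; rewrite -(compm1 f) -(compm1 g) -ij -!compA e.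
Qed.

Lemma tensDl (C : monoidal) (X Y Z W : C) (g : Hom Y Z) (f : Hom X Y) :
  (g ∘ f) ⊗₁ idm W = (g ⊗₁ idm W) ∘ (f ⊗₁ idm W).
Proof. by rewrite -tensD comp1m. Qed.

Lemma tensDr (C : monoidal) (X Y Z W : C) (g : Hom Y Z) (f : Hom X Y) :
  idm W ⊗₁ (g ∘ f) = (idm W ⊗₁ g) ∘ (idm W ⊗₁ f).
Proof. by rewrite -tensD comp1m. Qed.

Lemma tens_lr (C : monoidal) (X X' Y Y' : C) (f : Hom X X') (g : Hom Y Y') :
  (f ⊗₁ idm Y') ∘ (idm X ⊗₁ g) = f ⊗₁ g.
Proof. by rewrite -tensD comp1m compm1. Qed.

Lemma tens_rl (C : monoidal) (X X' Y Y' : C) (f : Hom X X') (g : Hom Y Y') :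
  (idm X' ⊗₁ g) ∘ (f ⊗₁ idm Y) = f ⊗₁ g.
Proof. by rewrite -tensD comp1m compm1. Qed.

Lemma assocV_nat (C : monoidal) (X X' Y Y' Z Z' : C)
    (f : Hom X X') (g : Hom Y Y') (h : Hom Z Z') :
  assocV X' Y' Z' ∘ (f ⊗₁ (g ⊗₁ h)) = ((f ⊗₁ g) ⊗₁ h) ∘ assocV X Y Z.
Proof.
apply: (cancel_mono (assocK X' Y' Z')).
rewrite (compE _ (assocVK _ _ _)) comp1m (compE _ (assoc_nat _ _ _)).
by rewrite compA assocVK compm1.
Qed.

Lemma lunitV_nat (C : monoidal) (X Y : C) (f : Hom X Y) :
  lunitV Y ∘ f = (idm 𝟏 ⊗₁ f) ∘ lunitV X.
Proof.
apply: (cancel_mono (lunitK Y)).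
rewrite (compE _ (lunitVK _)) comp1m (compE _ (lunit_nat _)).
by rewrite compA lunitVK compm1.
Qed.

Lemma runitV_nat (C : monoidal) (X Y : C) (f : Hom X Y) :
  runitV Y ∘ f = (f ⊗₁ idm 𝟏) ∘ runitV X.
Proof.
apply: (cancel_mono (runitK Y)).
rewrite (compE _ (runitVK _)) comp1m (compE _ (runit_nat _)).
by rewrite compA runitVK compm1.
Qed.

Lemma tens1l_inj (C : monoidal) (X Y : C) (f g : Hom X Y) :
  idm 𝟏 ⊗₁ f = idm 𝟏 ⊗₁ g -> f = g.
Proof.
move=> e; apply: (cancel_epi (lunitVK X)).
by rewrite -!lunit_nat e.
Qed.

Lemma tens1r_inj (C : monoidal) (X Y : C) (f g : Hom X Y) :
  f ⊗₁ idm 𝟏 = g ⊗₁ idm 𝟏 -> f = g.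
Proof.
move=> e; apply: (cancel_epi (runitVK X)).
by rewrite -!runit_nat e.
Qed.

Lemma tensl_inv (C : monoidal) (X Y Z : C) (f : Hom X Y) (g : Hom Y X) :
  f ∘ g = idm Y -> (f ⊗₁ idm Z) ∘ (g ⊗₁ idm Z) = idm (Y ⊗ Z).
Proof. by move=> e; rewrite -tensDl e tens1. Qed.

Lemma tensr_inv (C : monoidal) (X Y Z : C) (f : Hom X Y) (g : Hom Y X) :
  f ∘ g = idm Y -> (idm Z ⊗₁ f) ∘ (idm Z ⊗₁ g) = idm (Z ⊗ Y).
Proof. by move=> e; rewrite -tensDr e tens1. Qed.

Lemma lunit_tens (C : monoidal) (X Y : C) :
  lunit (X ⊗ Y) ∘ assoc 𝟏 X Y = lunit X ⊗₁ idm Y.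
Proof.
apply: tens1l_inj; apply: (cancel_epi (assocVK 𝟏 (𝟏 ⊗ X) Y)).
apply: (cancel_epi (tensl_inv Y (assocVK 𝟏 𝟏 X))).
rewrite tensDr !compA pentagon (compE _ (triangle _ _)) -(tens1 X Y) -assoc_nat.
by rewrite -triangle tensDl (compE _ (assoc_nat _ _ _)) compA.
Qed.

Lemma runit_tens (C : monoidal) (X Y : C) :
  (idm X ⊗₁ runit Y) ∘ assoc X Y 𝟏 = runit (X ⊗ Y).
Proof.
apply: tens1r_inj; apply: (cancel_mono (assocK X Y 𝟏)).
rewrite tensDl (compE _ (assoc_nat _ _ _)) -triangle tensDr !compA pentagon.
rewrite (compE _ (eq_sym (assoc_nat _ _ _))) tens1.
by rewrite compA triangle.
Qed.

Lemma lunit_unit (C : monoidal) (X : C) : lunit (𝟏 ⊗ X) = idm 𝟏 ⊗₁ lunit X.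
Proof. by apply: (cancel_mono (lunitK X)); rewrite lunit_nat. Qed.

Lemma lunit1_runit1 (C : monoidal) : lunit 𝟏 = runit 𝟏 :> @Hom C _ _.
Proof. by apply: tens1r_inj; rewrite -lunit_tens lunit_unit triangle. Qed.

Lemma assoc_runitV (C : monoidal) (X Y : C) :
  assocV X Y 𝟏 ∘ (idm X ⊗₁ runitV Y) = runitV (X ⊗ Y).
Proof.
apply: (cancel_mono (runitK (X ⊗ Y))); rewrite runitVK -runit_tens compA.
by rewrite (compE _ (assocVK _ _ _)) comp1m tensr_inv // runitVK.
Qed.

Lemma assoc_lunitV (C : monoidal) (X Y : C) :
  assoc 𝟏 X Y ∘ (lunitV X ⊗₁ idm Y) = lunitV (X ⊗ Y).
Proof.
apply: (cancel_mono (lunitK (X ⊗ Y))).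
by rewrite lunitVK (compE _ (lunit_tens _ _)) tensl_inv // lunitVK.
Qed.

Lemma triangleV (C : monoidal) (X Y : C) :
  assoc X 𝟏 Y ∘ (runitV X ⊗₁ idm Y) = idm X ⊗₁ lunitV Y.
Proof.
apply: (cancel_mono (tensr_inv X (lunitK Y))).
rewrite (compE _ (triangle _ _)) tensl_inv ?runitVK //.
by rewrite tensr_inv // lunitVK.
Qed.

Lemma pentagonV (C : monoidal) (W X Y Z : C) :
  assoc (W ⊗ X) Y Z ∘ (assocV W X Y ⊗₁ idm Z)
  = assocV W X (Y ⊗ Z) ∘ (idm W ⊗₁ assoc X Y Z) ∘ assoc W (X ⊗ Y) Z.
Proof.
apply: (cancel_epi (tensl_inv Z (assocVK W X Y))).
rewrite !compA pentagon (compE _ (assocK _ _ _)) comp1m.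
by rewrite (tensl_inv _ (assocK _ _ _)) compm1.
Qed.

Lemma pentagonV' (C : monoidal) (W X Y Z : C) :
  assocV (W ⊗ X) Y Z ∘ assocV W X (Y ⊗ Z)
  = (assocV W X Y ⊗₁ idm Z) ∘ assocV W (X ⊗ Y) Z ∘ (idm W ⊗₁ assocV X Y Z).
Proof.
apply: (cancel_mono (assocK (W ⊗ X) Y Z)).
rewrite (compE _ (assocVK _ _ _)) comp1m (compE _ (pentagonV _ _ _ _)) !compA.
rewrite (compE _ (assocVK _ _ _)) comp1m.
by rewrite (tensr_inv _ (assocVK _ _ _)) compm1.
Qed.

Lemma ev_coev_obj (C : monoidal) (X : C) (dX : left_dual X) :
  (idm X ⊗₁ ev dX) ∘ assoc X dX X ∘ (coev dX ⊗₁ idm X) = runitV X ∘ lunit X.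
Proof.
apply: (cancel_mono (runitK X)); apply: (cancel_epi (lunitK X)).
rewrite !compA (zigzag_obj (ldual_duality dX)) lunitVK compm1.
by rewrite runitVK.
Qed.

Lemma ev_coev_dual (C : monoidal) (X : C) (dX : left_dual X) :
  (ev dX ⊗₁ idm dX) ∘ assocV dX X dX ∘ (idm dX ⊗₁ coev dX)
  = lunitV dX ∘ runit dX.
Proof.
apply: (cancel_mono (lunitK dX)); apply: (cancel_epi (runitK dX)).
rewrite !compA (zigzag_dual (ldual_duality dX)) runitVK compm1.
by rewrite lunitVK.
Qed.

Definition untransp (C : monoidal) (X : C) (dX : left_dual X) (W Z : C)
    (f : Hom W (Z ⊗ dX)) : Hom (W ⊗ X) Z :=
  runit Z ∘ (idm Z ⊗₁ ev dX) ∘ assoc Z dX X ∘ (f ⊗₁ idm X).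

Lemma transpK (C : monoidal) (X : C) (dX : left_dual X) (W Z : C)
    (g : Hom (W ⊗ X) Z) : untransp (transp dX g) = g.
Proof.
rewrite /untransp /transp !tensDl (compE _ (assoc_nat _ _ _)) !compA tens1.
rewrite (compE _ (pentagonV _ _ _ _)) !compA (compE _ (assoc_nat _ _ _)) !compA.
rewrite triangleV (compE _ (tens_rl _ _)) -(tens_lr g (ev dX)) !compA.
rewrite -(tens1 W X) (compE _ (eq_sym (assocV_nat _ _ _))) !compA.
rewrite -!tensDr (compE3 _ (ev_coev_obj dX)) !compA.
by rewrite lunitVK compm1 assoc_runitV -runitV_nat (compE _ (runitVK _)) comp1m.
Qed.

Lemma untranspK (C : monoidal) (X : C) (dX : left_dual X) (W Z : C)
    (f : Hom W (Z ⊗ dX)) : transp dX (untransp f) = f.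
Proof.
rewrite /untransp /transp !tensDl !compA (compE _ (eq_sym (assocV_nat _ _ _))).
rewrite tens1 !compA (compE _ (tens_lr _ _)) -(tens_rl f (coev dX)) !compA -runitV_nat.
rewrite -assoc_runitV -(tens1 Z dX) !compA (compE _ (eq_sym (assocV_nat _ _ _))).
rewrite !compA (compE _ (pentagonV' _ _ _ _)) !compA.
rewrite (compE _ (tensl_inv _ (assocVK _ _ _))) comp1m.
rewrite (compE _ (eq_sym (assocV_nat _ _ _))) !compA.
rewrite -(compA (idm Z ⊗₁ (idm dX ⊗₁ coev dX))) -tensDr.
rewrite -(compA (idm Z ⊗₁ assocV _ _ _)) -tensDr.
rewrite -(compA (idm Z ⊗₁ (ev dX ⊗₁ idm dX))) -tensDr.
rewrite (compE3 _ (ev_coev_dual dX)) compA runitVK compm1 -triangleV !compA.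
rewrite (compE _ (assocK _ _ _)) comp1m.
by rewrite (compE _ (tensl_inv _ (runitVK _))) comp1m.
Qed.

Lemma untransp_unit (C : monoidal) (X : C) (dX : left_dual X) (W : C)
    (f : Hom W (𝟏 ⊗ dX)) :
  untransp f = ev dX ∘ ((lunit dX ∘ f) ⊗₁ idm X).
Proof.
rewrite /untransp -lunit1_runit1 (compE _ (lunit_nat _)) !compA.
by rewrite (compE _ (lunit_tens _ _)) -tensDl.
Qed.

Lemma ev_transp (C : monoidal) (X : C) (dX : left_dual X) (W : C)
    (g : Hom (W ⊗ X) 𝟏) : ev dX ∘ ((lunit dX ∘ transp dX g) ⊗₁ idm X) = g.
Proof. by rewrite -untransp_unit transpK. Qed.

Lemma untransp_inj (C : monoidal) (X : C) (dX : left_dual X) (W Z : C)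
    (f g : Hom W (Z ⊗ dX)) : untransp f = untransp g -> f = g.
Proof. by move=> e; rewrite -(untranspK f) -(untranspK g) e. Qed.

Lemma ev_inj (C : monoidal) (X : C) (dX : left_dual X) (W : C)
    (f g : Hom W dX) :
  ev dX ∘ (f ⊗₁ idm X) = ev dX ∘ (g ⊗₁ idm X) -> f = g.
Proof.
move=> e; apply: (cancel_mono (lunitVK dX)); apply: untransp_inj.
by rewrite !untransp_unit -!compA lunitVK !comp1m.
Qed.

Lemma dualmE (C : monoidal) (X Y : C) (dX : left_dual X) (dY : left_dual Y)
    (f : Hom X Y) :
  ev dX ∘ (dualm dX dY f ⊗₁ idm X) = ev dY ∘ (idm dY ⊗₁ f).
Proof. exact: ev_transp. Qed.

Lemma ev_tensE (C : monoidal) (X Y : C) (dX : left_dual X) (dY : left_dual Y)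
    (W : C) (f : Hom W (dY ⊗ dX)) :
  ev_tens dX dY ∘ (f ⊗₁ idm (X ⊗ Y))
  = ev dY ∘ (untransp f ⊗₁ idm Y) ∘ assocV W X Y.
Proof.
rewrite /ev_tens -(tens1 X Y) !compA assocV_nat.
by rewrite -(compA (_ ⊗₁ idm Y)) -tensDl !compA.
Qed.

Lemma dual_tensE (C : monoidal) (X Y : C) (dX : left_dual X)
    (dY : left_dual Y) (dXY : left_dual (X ⊗ Y)) :
  ev_tens dX dY ∘ (dual_tens dX dY dXY ⊗₁ idm (X ⊗ Y)) = ev dXY.
Proof.
rewrite ev_tensE transpK (compE _ (ev_transp _ _)) compA.
by rewrite assocVK compm1.
Qed.

Lemma dual_tensK (C : monoidal) (X Y : C) (dX : left_dual X)
    (dY : left_dual Y) (dXY : left_dual (X ⊗ Y)) :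
  dual_tensV dX dY dXY ∘ dual_tens dX dY dXY = idm dXY.
Proof.
apply: ev_inj; rewrite tensDl (compE _ (ev_transp _ _)) dual_tensE.
by rewrite tens1 compm1.
Qed.

Lemma dual_tensVK (C : monoidal) (X Y : C) (dX : left_dual X)
    (dY : left_dual Y) (dXY : left_dual (X ⊗ Y)) :
  dual_tens dX dY dXY ∘ dual_tensV dX dY dXY = idm (dY ⊗ dX).
Proof.
move: (dual_tensE dX dY dXY); move: (dual_tens dX dY dXY) => t tE.
apply: untransp_inj; apply: ev_inj; apply: (cancel_epi (assocK _ _ _)).
rewrite !compA -!ev_tensE tensDl (compE _ tE).
by rewrite ev_transp tens1 compm1.
Qed.

Lemma braid_unit (C : braided) (X : C) : runit X ∘ braid 𝟏 X = lunit X.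
Proof.
apply: tens1r_inj; apply: (cancel_epi (assocK 𝟏 X 𝟏)).
rewrite tensDl !compA -lunit_tens compA assocVK compm1.
apply: (cancel_epi (tensr_inv 𝟏 (braidVK 𝟏 X))).
rewrite !compA -hexagon_r lunit_nat -triangle !compA.
rewrite (compE _ (assocVK _ _ _)) comp1m.
rewrite (compE _ (eq_sym (braid_nat _ _))) compA lunit1_runit1 -triangle.
by rewrite compA assocVK compm1 lunit_unit.
Qed.

Lemma lact1 (C : braided) (A : algebra C) (M : rmodule A) :
  lact M ∘ (aone A ⊗₁ idm M) = lunit M.
Proof. by rewrite /lact compA braid_nat -compA ract1 braid_unit. Qed.

Lemma lactA (C : braided) (A : comm_algebra C) (M : rmodule A) :
  lact M ∘ (idm A ⊗₁ lact M) ∘ assoc A A M = lact M ∘ (amul A ⊗₁ idm M).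
Proof.
have hex : assoc M A A ∘ braid A (M ⊗ A)
    = (idm M ⊗₁ braid A A) ∘ assoc M A A ∘ (braid A M ⊗₁ idm A)
        ∘ assocV A M A.
  apply: (cancel_epi (assocVK A M A)).
  by rewrite !compA hexagon_l assocK compm1.
rewrite /lact !compA tensDr !compA (compE _ (braid_nat _ _)) !compA.
rewrite (compE _ (ractA M)) !compA (compE _ hex) !compA.
rewrite -(compA (idm M ⊗₁ amul A)) -tensDr amulC.
rewrite -(compA (assocV A M A)) -(compA (braid A M ⊗₁ idm A)) -hexagon_r !compA.
by rewrite assocK compm1 (compE _ (assocVK _ _ _)) comp1m braid_nat.
Qed.

Lemma untransp_comp (C : monoidal) (X : C) (dX : left_dual X) (V W Z : C)
    (f : Hom W (Z ⊗ dX)) (k : Hom V W) :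
  untransp (f ∘ k) = untransp f ∘ (k ⊗₁ idm X).
Proof. by rewrite /untransp tensDl !compA. Qed.

Lemma dual_ractE (C : ribbon) (A : algebra C) (M : rmodule A) :
  ev (ldual M) ∘ (dual_ract M ⊗₁ idm M)
  = ev (ldual M) ∘ (idm (ldual M) ⊗₁ lact M) ∘ assoc (ldual M) A M.
Proof.
rewrite /dual_ract -/(untransp _) untransp_comp transpK tensDl.
rewrite (compE _ (ev_transp _ _)) compA assoc_nat tens1.
by rewrite (compE _ (dualmE _ _ _)) compA.
Qed.

Lemma dual_ractA (C : ribbon) (A : comm_algebra C) (M : rmodule A) :
  dual_ract M ∘ (dual_ract M ⊗₁ idm A)
  = dual_ract M ∘ (idm (ldual M) ⊗₁ amul A) ∘ assoc (ldual M) A A.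
Proof.
move: (dual_ractE M); move: (dual_ract M) => a aE.
apply: ev_inj; rewrite !tensDl !(compE _ aE) !compA.
rewrite (compE _ (assoc_nat _ _ _)) !compA assoc_nat tens1.
rewrite (compE _ (tens_rl _ _)) -tens_lr !compA (compE _ aE) !compA.
rewrite -(tens1 (ldual M) A) (compE _ (assoc_nat _ _ _)) !compA -pentagon.
have e : (idm (ldual M) ⊗₁ lact M) ∘ (idm (ldual M) ⊗₁ (idm A ⊗₁ lact M))
      ∘ (idm (ldual M) ⊗₁ assoc A A M)
    = (idm (ldual M) ⊗₁ lact M) ∘ (idm (ldual M) ⊗₁ (amul A ⊗₁ idm M)).
  by rewrite -!tensDr lactA.
by rewrite (compE3 _ e) !compA.
Qed.

Lemma dual_ract1 (C : ribbon) (A : algebra C) (M : rmodule A) :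
  dual_ract M ∘ (idm (ldual M) ⊗₁ aone A) = runit (ldual M).
Proof.
move: (dual_ractE M); move: (dual_ract M) => a aE.
apply: ev_inj; rewrite tensDl (compE _ aE) !compA assoc_nat.
by rewrite -(compA (idm _ ⊗₁ _)) -tensDr lact1 triangle.
Qed.

(** The module D(M) on the left dual M^*. *)
Definition dual_module (C : ribbon) (A : comm_algebra C) (M : rmodule A) :
    rmodule A :=
  RModule (dual_ractA M) (dual_ract1 M).

(* Main.v *)
From Corelib Require Import ssreflect.
Require Import Defs.

Set Implicit Arguments.
Unset Strict Implicit.
Unset Printing Implicit Defensive.

(** The balancing axiom trades the double braiding for twists, so a module [N]
    is local iff its action intertwines the twists. Transposing this condition
    for [D(M)] across the evaluation moves the twist of [M^*] to [M] and the
    action of [D(M)] to the left action [l] of [M]; when [M] is local, it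
    becomes [l = l (θ_A^2 ⊗ id)]. For [M = A], composing with the unit
    of [A] recovers [θ_A^2 = id]. *)

Local Open Scope cat_scope.

(** The zigzag identity on [X] rebuilds a morphism into [X] from its pairing with [dX], just as
    [ev_inj] rests on the other zigzag. *)
Lemma ev_injr (C : monoidal) (X : C) (dX : left_dual X) (W : C)
    (f g : Hom W X) :
  ev dX ∘ (idm dX ⊗₁ f) = ev dX ∘ (idm dX ⊗₁ g) -> f = g.
Proof.
have untwist h : h = runit X ∘ (idm X ⊗₁ (ev dX ∘ (idm dX ⊗₁ h)))
    ∘ assoc X dX W ∘ (coev dX ⊗₁ idm W) ∘ lunitV W.
  rewrite tensDr !compA (compE _ (eq_sym (assoc_nat _ _ _))) !compA tens1.
  rewrite (compE _ (tens_rl _ _)) -(tens_lr (coev dX)) !compA -lunitV_nat.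
  move: (zigzag_obj (ldual_duality dX)) => /(f_equal (fun k => k ∘ h)).
  by rewrite !compA comp1m => ->.
by move=> e; rewrite (untwist f) (untwist g) e.
Qed.

Lemma is_local_twist (C : ribbon) (A : algebra C) (N : rmodule A) :
  is_local N <-> twist N ∘ ract N = ract N ∘ (twist N ⊗₁ twist A).
Proof.
(* Naturality of the twist at [ract N], then balancing on [N ⊗ A]; the twists slide past both
   braidings. *)
have -> : twist N ∘ ract N
    = (ract N ∘ braid A N ∘ braid N A) ∘ (twist N ⊗₁ twist A).
  rewrite twist_nat twist_tens !compA braid_nat.
  by rewrite (compE _ (braid_nat _ _)) compA.
split=> [-> // | e].
apply: (cancel_epi (j := twistV N ⊗₁ twistV A)) e.
by rewrite -tensD !twistVK tens1.
Qed.

Lemma dual_module_local_twist (C : ribbon) (A : comm_algebra C)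
    (M : rmodule A) :
  is_local (dual_module M) <->
  lact M ∘ (idm A ⊗₁ twist M) = twist M ∘ lact M ∘ (twist A ⊗₁ idm M).
Proof.
apply: (iff_trans (is_local_twist _)) => /=.
move: (dual_ractE M); move: (dual_ract M) (lact M) => a l aE.
(* Duality reverses composition: a twist applied after [a] becomes one applied before [l] on the
   factor [M], and vice versa in [evR]. *)
have evL : ev (ldual M) ∘ ((twist (ldual M) ∘ a) ⊗₁ idm M)
    = ev (ldual M) ∘ (idm _ ⊗₁ (l ∘ (idm A ⊗₁ twist M)))
        ∘ assoc (ldual M) A M.
  rewrite -twist_dual tensDl (compE _ (dualmE _ _ _)) !compA tens_rl -tens_lr.
  rewrite (compE _ aE) !compA -(tens1 (ldual M) A) assoc_nat.
  by rewrite tensDr compA.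
have evR : ev (ldual M)
      ∘ ((a ∘ (twist (ldual M) ⊗₁ twist A)) ⊗₁ idm M)
    = ev (ldual M) ∘ (idm _ ⊗₁ (twist M ∘ l ∘ (twist A ⊗₁ idm M)))
        ∘ assoc (ldual M) A M.
  rewrite tensDl (compE _ aE) !compA assoc_nat.
  rewrite (compE _ (eq_sym (tensD _ _ _ _))) comp1m -(tens_lr (twist _)) !compA.
  by rewrite -twist_dual (compE _ (dualmE _ _ _)) !tensDr !compA.
split=> [e | e].
  (* Both sides now differ only in the second argument of the evaluation. *)
  apply: (ev_injr (dX := ldual M)).
  apply: (cancel_epi (assocVK (ldual M) A M)).
  by rewrite !compA -evL -evR e.
by apply: ev_inj; rewrite evL evR e.
Qed.

Lemma dual_module_local (C : ribbon) (A : comm_algebra C) (M : rmodule A) :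
  is_local M ->
  is_local (dual_module M) <->
  lact M ∘ ((twist A ∘ twist A) ⊗₁ idm M) = lact M.
Proof.
move=> /is_local_twist locM; apply: (iff_trans (dual_module_local_twist M)).
(* Locality of [M], carried through the braiding, gives [twist M ∘ lact M = lact M ∘ (twist A ⊗₁
   twist M)]; this supplies the second [twist A], and the invertible [twist M] then cancels. *)
have -> : twist M ∘ lact M ∘ (twist A ⊗₁ idm M)
    = (lact M ∘ ((twist A ∘ twist A) ⊗₁ idm M)) ∘ (idm A ⊗₁ twist M).
  rewrite compA tens_lr /lact !compA (compE _ locM) compA.
  rewrite (compE _ (eq_sym (braid_nat _ _))) compA.
  by rewrite -tensD compm1.
split=> [e | -> //].
apply: (cancel_epi (tensr_inv A (twistVK M))).
by rewrite e.
Qed.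

Lemma regular_local (C : braided) (A : comm_algebra C) :
  is_local (regular A).
Proof. by rewrite /is_local /= (compE _ (amulC A)) amulC. Qed.

Theorem proposition3p13 (C : ribbon) (coeqC : has_coequalizers C)
    (A : comm_algebra C) :
  (is_local (dual_module (regular A)) <-> twist A ∘ twist A = idm A) /\
  (twist A ∘ twist A = idm A ->
    forall M : rmodule A, is_local M -> is_local (dual_module M)).
Proof.
have loc_dual : twist A ∘ twist A = idm A ->
    forall M : rmodule A, is_local M -> is_local (dual_module M).
  by move=> sq M locM; apply/(dual_module_local locM); rewrite sq tens1 compm1.
split; last exact: loc_dual.
split=> [|sq]; last exact: (loc_dual sq _ (regular_local A)).
move=> /(dual_module_local (regular_local A)).
rewrite /lact /= amulC => e.
(* The unit goes into the second factor of [e], where [amul A] reduces to the invertible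
   [runit A]. *)
apply: (cancel_epi (runitVK A)).
by rewrite -runit_nat -amul1r compA tens_rl -tens_lr (compE _ e) comp1m.
Qed.
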